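(* Let $c\ge3$ be a constant and $\phi:\mathbb{N}\to(0,1]$ a monotonically decreasing function. Let $\sigma\in\Sigma$ be such that for every $n\ge2$, \[ \sum_{\frac nc\le k\le n-\frac nc}\sigma(k,n-k)\ge\phi(n). \] Then \[ \mathcal{D}_\sigma(n)\in\mathcal{O}\left(\frac{n}{\phi(n)\log n}\right). \]
   Context: Binary trees are terms over a leaf symbol $a$ and a binary symbol $f$: $a$ is a binary tree, and if $t_1,t_2$ are binary trees then so is $f(t_1,t_2)$. $|t|$ is the number of leaves of $t$, $\mathcal{T}_n$ the set of binary trees with $n$ leaves. $|\mathcal{D}_t|$ (the size of the minimal DAG of $t$) is the number of pairwise non-isomorphic subtrees of $t$. $\Sigma$ is the set of functions $\sigma:(\mathbb{N}\setminus\{0\})^2\to[0,1]$ with $\sum_{i,j\ge1,\, i+j=k}\sigma(i,j)=1$ for every integer $k\ge2$. For $\sigma\in\Sigma$, $P_\sigma(a)=1$ and $P_\sigma(f(u,v))=\sigma(|u|,|v|)P_\sigma(u)P_\sigma(v)$, and $\mathcal{D}_\sigma(n)=\sum_{t\in\mathcal{T}_n}P_\sigma(t)|\mathcal{D}_t|$. A sum $\sum_{q_0\le k\le q_1}$ with rational bounds ranges over integers $k$ from $\lceil q_0\rceil$ to $\lfloor q_1\rfloor$. $\log$ is the binary logarithm. *)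

(* Defs.v *)
From HB Require Import structures.
From mathcomp Require Import all_boot all_order all_algebra.
From mathcomp Require Import all_classical all_reals all_analysis.
Set Implicit Arguments.
Unset Strict Implicit.
Unset Printing Implicit Defensive.
Import Order.TTheory GRing.Theory Num.Theory.
Import numFieldNormedType.Exports.
Local Open Scope classical_set_scope.
Local Open Scope ring_scope.

Inductive btree : Type := Leaf | Node of btree & btree.

Fixpoint btree_code (t : btree) : GenTree.tree unit :=
  match t with
  | Leaf => GenTree.Leaf tt
  | Node u v => GenTree.Node 0 [:: btree_code u; btree_code v]
  end.

Fixpoint btree_decode (g : GenTree.tree unit) : option btree :=
  match g with
  | GenTree.Leaf _ => Some Leaf
  | GenTree.Node _ [:: g1; g2] =>
      match btree_decode g1, btree_decode g2 with
      | Some u, Some v => Some (Node u v)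
      | _, _ => None
      end
  | _ => None
  end.

Lemma btree_codeK : pcancel btree_code btree_decode.
Proof. by elim=> //= u -> v ->. Qed.

HB.instance Definition _ := Countable.copy btree (pcan_type btree_codeK).

Fixpoint leaves (t : btree) : nat :=
  match t with
  | Leaf => 1
  | Node u v => leaves u + leaves v
  end.

(* Trees are ordered terms, so isomorphism of subtrees is equality. *)
Fixpoint subtrees (t : btree) : seq btree :=
  t :: match t with
       | Leaf => [::]
       | Node u v => subtrees u ++ subtrees v
       end.

Definition dag_size (t : btree) : nat := size (undup (subtrees t)).

Definition trees_of_size (n : nat) : set btree := [set t | leaves t = n].

Lemma leaves_gt0 (t : btree) : (0 < leaves t)%N.
Proof. by elim: t => //= u Hu v _; rewrite addn_gt0 Hu. Qed.

(* Needed for the sum over trees_of_size n in avg_dag_size to be meaningful: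
   \sum_(t \in A) is 0 by convention when the support is infinite. *)
Lemma finite_trees_of_size (n : nat) : finite_set (trees_of_size n).
Proof.
suff H : finite_set [set t | (leaves t <= n)%N].
  by apply: (sub_finite_set _ H) => t /= ->.
elim: n => [|n IHn].
  apply: (sub_finite_set _ (finite_set0 btree)) => t /=.
  by have := leaves_gt0 t; case: (leaves t).
set A := [set t | (leaves t <= n)%N] in IHn.
have F : finite_set ([set Leaf] `|` (fun p => Node p.1 p.2) @` (A `*` A)).
  by rewrite finite_setU; split=> //; apply/finite_image/finite_setX.
apply: (sub_finite_set _ F) => -[|u v] /= H; first by left.
right; exists (u, v) => //; split; rewrite /A /= -ltnS; apply: leq_trans H.
  by rewrite -[ltnLHS]addn0 ltn_add2l leaves_gt0.
by rewrite -[ltnLHS]add0n ltn_add2r leaves_gt0.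
Qed.

(* Only the values of sigma at positive arguments are constrained (and used). *)
Definition leaf_centric (R : realType) (sigma : nat -> nat -> R) : Prop :=
  (forall i j : nat, (0 < i)%N -> (0 < j)%N -> 0 <= sigma i j <= 1) /\
  (forall k : nat, (2 <= k)%N -> \sum_(1 <= i < k) sigma i (k - i)%N = 1).

Fixpoint tree_prob (R : realType) (sigma : nat -> nat -> R) (t : btree) : R :=
  match t with
  | Leaf => 1
  | Node u v => sigma (leaves u) (leaves v) * tree_prob sigma u * tree_prob sigma v
  end.

Definition avg_dag_size (R : realType) (sigma : nat -> nat -> R) (n : nat) : R :=
  \sum_(t \in trees_of_size n) tree_prob sigma t * (dag_size t)%:R.

Definition log2 (R : realType) (x : R) : R := ln x / ln 2.

(* Main.v *)
(** For a threshold [k], the DAG of a tree has at most one vertex for each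
    occurrence of a subtree with at least [k] leaves, plus one for each of the
    at most [4 ^ k] binary trees with fewer than [k] leaves (a preorder
    traversal encodes a tree with [m] leaves by [2m - 1] bits).  The expected
    number of large subtrees is at most [c n / (phi n k)]: in the recurrence at
    the root, a balanced split occurs with probability at least [phi n].
    Taking [k = floor(log n / 4)] makes [4 ^ k] of order at most [sqrt n]. *)
Require Import Defs.
From mathcomp Require Import all_boot all_order all_algebra.
From mathcomp Require Import all_classical all_reals all_analysis.
From mathcomp Require Import finmap zify ring lra.
Import Order.TTheory GRing.Theory Num.Theory.
Import numFieldNormedType.Exports.
Local Open Scope classical_set_scope.
Local Open Scope ring_scope.

(** * Prefix codes and the number of small trees *)

Fixpoint prefix_code (t : btree) : seq bool :=
  match t with
  | Leaf => [:: false]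
  | Node u v => true :: prefix_code u ++ prefix_code v
  end.

Lemma size_prefix_code (t : btree) : (size (prefix_code t)).+1 = (leaves t).*2.
Proof.
elim: t => //= u IHu v IHv.
by rewrite doubleD -IHu -IHv size_cat addSn addnS.
Qed.

Lemma prefix_code_inj (t1 t2 : btree) (s1 s2 : seq bool) :
  prefix_code t1 ++ s1 = prefix_code t2 ++ s2 -> t1 = t2.
Proof.
(* The induction needs equality of the remainders too: after the left subtrees are matched, the
   remainders hold the codes of the right ones. *)
suff : prefix_code t1 ++ s1 = prefix_code t2 ++ s2 -> t1 = t2 /\ s1 = s2.
  by move=> H /H[].
elim: t1 t2 s1 s2 => [|u1 IHu v1 IHv] [|u2 v2] s1 s2 //=; first by case.
by case; rewrite -!catA => /IHu[-> /IHv[-> ->]].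
Qed.

(** A tree with fewer than [k] leaves has a code of fewer than [2k] bits. Padded to exactly [2k]
    bits, the codes stay distinct because no code is a proper prefix of another, and there are
    [4 ^ k] words of that length. *)
Lemma size_uniq_small_trees (k : nat) (s : seq btree) :
  uniq s -> {in s, forall t, (leaves t < k)%N} -> (size s <= 4 ^ k)%N.
Proof.
move=> us sk.
pose pad (t : btree) := prefix_code t ++ nseq (k.*2 - size (prefix_code t)) false.
have size_pad t : t \in s -> size (pad t) == k.*2.
  move=> /sk tk; rewrite size_cat size_nseq subnKC//.
  by rewrite (leq_trans (leqnSn _))// size_prefix_code leq_double ltnW.
pose code (t : btree) := insubd (nseq_tuple k.*2 false) (pad t).
have code_val t : t \in s -> val (code t) = pad t.
  by move=> ts; rewrite val_insubd size_pad.
have code_inj : {in s &, injective code}.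
  move=> t1 t2 t1s t2s /(congr1 val).
  by rewrite !code_val// => /prefix_code_inj.
have /card_uniqP : uniq (map code s) by rewrite map_inj_in_uniq.
rewrite size_map => <-; apply: leq_trans (max_card _) _.
by rewrite card_tuple card_bool -mul2n expnM.
Qed.

(** Occurrences are counted with multiplicity, unlike in [dag_size]; this makes the count additive
    over the two children of a node. *)
Definition big_subtrees (k : nat) (t : btree) : nat :=
  count (fun s => k <= leaves s)%N (subtrees t).

Lemma dag_size_le (k : nat) (t : btree) :
  (dag_size t <= big_subtrees k t + 4 ^ k)%N.
Proof.
pose big s := (k <= leaves s)%N.
rewrite /dag_size -(count_predC big) leq_add//.
  by rewrite /big_subtrees -!size_filter -/big filter_undup size_undup.
rewrite -size_filter; apply: size_uniq_small_trees.
  by rewrite filter_uniq// undup_uniq.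
by move=> s; rewrite mem_filter /= -ltnNge => /andP[].
Qed.

Lemma leaves_subtrees (t s : btree) : s \in subtrees t -> (leaves s <= leaves t)%N.
Proof.
elim: t => [|u IHu v IHv] /=; first by rewrite inE => /eqP->.
rewrite inE mem_cat => /or3P[/eqP->//|/IHu|/IHv] /leq_trans; apply.
  exact: leq_addr.
exact: leq_addl.
Qed.

Lemma big_subtrees_small (k : nat) (t : btree) :
  (leaves t < k)%N -> big_subtrees k t = 0%N.
Proof.
move=> tk; apply/eqP; rewrite /big_subtrees -leqn0 leqNgt -has_count -all_predC.
by apply/allP => s /leaves_subtrees st /=; rewrite -ltnNge (leq_ltn_trans st).
Qed.

Lemma big_subtrees_node (k : nat) (u v : btree) : (k <= leaves u + leaves v)%N ->
  big_subtrees k (Node u v) = (1 + (big_subtrees k u + big_subtrees k v))%N.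
Proof. by rewrite /big_subtrees /= count_cat => ->. Qed.

(** * Enumeration of the trees of a given size *)

Definition tree_seq (n : nat) : seq btree := fset_set (trees_of_size n).

Lemma mem_tree_seq (n : nat) (t : btree) : (t \in tree_seq n) = (leaves t == n).
Proof.
rewrite in_fset_set; last exact: finite_trees_of_size.
by apply/idP/eqP; rewrite in_setE.
Qed.

Lemma perm_tree_seq (n : nat) : (2 <= n)%N ->
  perm_eq (tree_seq n)
    [seq t | i <- index_iota 1 n,
             t <- [seq Node u v | u <- tree_seq i, v <- tree_seq (n - i)]].
Proof.
move=> n2; apply: uniq_perm; first exact: fset_uniq.
  apply: allpairs_uniq_dep => [|i _|]; first exact: iota_uniq.
    apply: allpairs_uniq; [exact: fset_uniq|exact: fset_uniq|].
    by move=> [u1 v1] [u2 v2] _ _ [-> ->].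
  move=> _ _ /allpairsPdep[i1 [t1 [_ t1i ->]]] /allpairsPdep[i2 [t2 [_ t2i ->]]] /=.
  move=> e; move: t1i; rewrite e => /allpairsP[[u1 v1] /= [ui1 _ e2]].
  move: t2i; rewrite e2 => /allpairsP[[u2 v2] /= [ui2 _ [e3 _]]].
  (* The left subtree of a node determines the block in which the node is listed. *)
  suff -> : i1 = i2 by [].
  by move: ui1 ui2; rewrite -e3 !mem_tree_seq => /eqP<- /eqP<-.
move=> t; rewrite mem_tree_seq; apply/eqP/allpairsPdep => [tn|].
  case: t tn => [|u v] /= tn; first by rewrite -tn in n2.
  have u0 := leaves_gt0 u; have v0 := leaves_gt0 v.
  exists (leaves u), (Node u v); split => //.
    by rewrite mem_index_iota u0 -tn -[ltnLHS]addn0 ltn_add2l.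
  apply/allpairsP; exists (u, v); split => //=; rewrite mem_tree_seq//.
  by rewrite -tn addKn.
move=> [i [_ [+ /allpairsP[[u v] /= [+ + ->]] ->]]] /=.
rewrite mem_index_iota !mem_tree_seq => /andP[_ /ltnW i_n] /eqP-> /eqP->.
exact: subnKC.
Qed.

(** * Expectations under the leaf-centric distribution *)

Section Average.
Variables (R : realType) (sigma : nat -> nat -> R).

Definition avg (g : btree -> R) (n : nat) : R :=
  \sum_(t <- tree_seq n) tree_prob sigma t * g t.

Lemma avg_dag_sizeE (n : nat) :
  avg_dag_size sigma n = avg (fun t => (dag_size t)%:R) n.
Proof. by rewrite /avg_dag_size fsbig_finite//; exact: finite_trees_of_size. Qed.

(** Given the size [i] of the left subtree, the two subtrees of the root are independent, hence the
    nested averages. *)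
Lemma avg_node (g : btree -> R) (n : nat) : (2 <= n)%N ->
  avg g n = \sum_(1 <= i < n) sigma i (n - i)%N *
              avg (fun u => avg (fun v => g (Node u v)) (n - i)) i.
Proof.
move=> n2; rewrite /avg (perm_big _ (perm_tree_seq n n2)) big_allpairs_dep /=.
apply: eq_bigr => i _; rewrite big_allpairs_dep /= mulr_sumr.
apply: eq_big_seq => u; rewrite mem_tree_seq => /eqP ui.
rewrite !mulr_sumr; apply: eq_big_seq => v; rewrite mem_tree_seq => /eqP vi.
by rewrite ui vi; ring.
Qed.

Lemma avg1 (g : btree -> R) : avg g 1 = g Leaf.
Proof.
have e : perm_eq (tree_seq 1) [:: Leaf].
  apply: uniq_perm => //; first exact: fset_uniq.
  move=> t; rewrite mem_tree_seq inE; case: t => // u v /=.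
  have u0 := leaves_gt0 u; have v0 := leaves_gt0 v.
  by transitivity false; [lia|apply/esym/eqP].
by rewrite /avg (perm_big _ e) big_seq1 mul1r.
Qed.

Lemma avgD (g h : btree -> R) (n : nat) :
  avg (fun t => g t + h t) n = avg g n + avg h n.
Proof. by rewrite -big_split; apply: eq_bigr => t _; rewrite mulrDr. Qed.

(** The total mass stays a factor here, since the proof that it equals 1 goes through this
    identity. *)
Lemma avg_cst_total (a : R) (n : nat) : avg (fun=> a) n = avg (fun=> 1) n * a.
Proof. by rewrite mulr_suml; apply: eq_bigr => t _; rewrite mulr1. Qed.

Lemma eq_avg (g h : btree -> R) (n : nat) :
  (forall t, leaves t = n -> g t = h t) -> avg g n = avg h n.
Proof.
move=> gh; apply: eq_big_seq => t; rewrite mem_tree_seq => /eqP tn.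
by rewrite gh.
Qed.

Hypothesis sigma_leaf_centric : leaf_centric sigma.

Lemma tree_prob_ge0 (t : btree) : 0 <= tree_prob sigma t.
Proof.
elim: t => //= u IHu v IHv; rewrite !mulr_ge0//.
by have /andP[] := sigma_leaf_centric.1 _ _ (leaves_gt0 u) (leaves_gt0 v).
Qed.

Lemma le_avg (g h : btree -> R) (n : nat) :
  (forall t, g t <= h t) -> avg g n <= avg h n.
Proof.
by move=> gh; apply: ler_sum => t _; rewrite ler_wpM2l// tree_prob_ge0.
Qed.

Lemma avg_total (n : nat) : (0 < n)%N -> avg (fun=> 1) n = 1.
Proof.
elim/ltn_ind: n => n IH n0.
have [->|n2] : n = 1%N \/ (2 <= n)%N by lia.
  by rewrite avg1.
rewrite avg_node// -[RHS](sigma_leaf_centric.2 n n2).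
apply: eq_big_nat => i /andP[i0 i_n].
rewrite avg_cst_total !IH ?mul1r ?mulr1//; lia.
Qed.

Lemma avg_cst (a : R) (n : nat) : (0 < n)%N -> avg (fun=> a) n = a.
Proof. by move=> n0; rewrite avg_cst_total avg_total// mul1r. Qed.

(** * The expected number of large subtrees *)

Lemma avg_big_subtrees_rec (k n : nat) : (2 <= n)%N -> (k <= n)%N ->
  let E := avg (fun t => (big_subtrees k t)%:R) in
  E n = 1 + \sum_(1 <= i < n) sigma i (n - i)%N * (E i + E (n - i)%N).
Proof.
move=> n2 kn E; rewrite /E avg_node//.
(* The 1 that counts the root is spread over the splits as the sum of [sigma], so that the two sides
   agree term by term. *)
rewrite -[X in _ = X + _](sigma_leaf_centric.2 n n2) -big_split.
apply: eq_big_nat => i /andP[i0 i_n] /=.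
rewrite -[X in X + _]mulr1 -mulrDr; congr (_ * _).
have ni0 : (0 < n - i)%N by rewrite subn_gt0.
transitivity (avg (fun u => 1 + ((big_subtrees k u)%:R
                + avg (fun v => (big_subtrees k v)%:R) (n - i))) i).
  apply: eq_avg => u ui.
  rewrite -(avg_cst (big_subtrees k u)%:R (n - i))// -avgD.
  rewrite -[X in _ = X + _](avg_cst 1 (n - i))// -avgD; apply: eq_avg => v vi.
  have kuv : (k <= leaves u + leaves v)%N by lia.
  by rewrite big_subtrees_node// !natrD.
by rewrite (avgD (fun=> 1)) avgD !avg_cst.
Qed.

Lemma avg_big_subtrees_small (k n : nat) : (n < k)%N ->
  avg (fun t => (big_subtrees k t)%:R) n = 0.
Proof.
move=> nk; rewrite /avg big_seq big1// => t; rewrite mem_tree_seq => /eqP tn.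
by rewrite big_subtrees_small ?mulr0// tn.
Qed.

(* The term [- 1 / p] makes the induction work: a split into parts of size at
   least [m / c] lowers the bound by [1 / p], and it has probability at least
   [p], which pays for the root. *)
Lemma avg_big_subtrees_le (c p : R) (k N : nat) :
  2 <= c -> 0 < p <= 1 -> (0 < k)%N ->
  (forall n : nat, (2 <= n <= N)%N ->
    p <= \sum_(i < n.+1 | n%:R / c <= i%:R <= n%:R - n%:R / c) sigma i (n - i)%N) ->
  forall m, (k <= m <= N)%N ->
  avg (fun t => (big_subtrees k t)%:R) m <= c * m%:R / (p * k%:R) - 1 / p.
Proof.
move=> c2 /andP[p0 p1] k0 sp m; set E := avg _.
have kR : (0 : R) < k%:R by rewrite ltr0n.
have c0 : 0 < c by lra.
have boundE (x : R) : c * x / (p * k%:R) - 1 / p = p^-1 * (c * (x / k%:R) - 1).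
  by field; rewrite !gt_eqF.
have pV0 : 0 < p^-1 by rewrite invr_gt0.
elim/ltn_ind: m => m IH /andP[km mN].
have m1 : (1 : R) <= m%:R / k%:R by rewrite ler_pdivlMr// mul1r ler_nat.
have [m_1|m2] : m = 1%N \/ (2 <= m)%N by lia.
  have k1 : k = 1%N by lia.
  rewrite m_1 /E avg1 boundE k1 divr1 mulr1 (_ : big_subtrees 1 Leaf = 1%N)//.
  rewrite (@le_trans _ _ p^-1)//; first by rewrite invf_ge1.
  by rewrite ler_peMr ?(ltW pV0)//; lra.
pose balanced (i : nat) := m%:R / c <= i%:R <= m%:R - m%:R / c.
set B := c * _ / _ - _.
have split_le i : (1 <= i < m)%N -> E i + E (m - i)%N <= B - p^-1 * (balanced i)%:R.
  move=> /andP[i0 im].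
  have mi : (m%:R : R) = i%:R + (m - i)%:R by rewrite -natrD subnKC// ltnW.
  have iR : (0 : R) < i%:R / k%:R by rewrite divr_gt0// ltr0n.
  have jR : (0 : R) < (m - i)%:R / k%:R by rewrite divr_gt0// ltr0n subn_gt0.
  have mij : m%:R / k%:R = i%:R / k%:R + (m - i)%:R / k%:R :> R by rewrite mi mulrDl.
  (* A part of size [j < k] contributes 0 instead of [c * j / k - 1]. In a balanced split
     [c * j >= m >= k], which makes up for the difference. *)
  have [bi bj] : (balanced i)%:R <= c * (i%:R / k%:R) /\
                 (balanced i)%:R <= c * ((m - i)%:R / k%:R) :> R.
    case: (boolP (balanced i)) => [/andP[h1 h2]|_]; last first.
      by split; rewrite mulr_ge0// ltW.
    have h3 : m%:R / c <= (m - i)%:R by lra.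
    have kmR : k%:R <= m%:R :> R by rewrite ler_nat.
    rewrite ler_pdivrMr// in h1; rewrite ler_pdivrMr// in h3.
    by split; rewrite mulrA ler_pdivlMr// mul1r mulrC; lra.
  have E_le j : (0 < j < m)%N ->
      E j <= p^-1 * (if (k <= j)%N then c * (j%:R / k%:R) - 1 else 0).
    move=> /andP[j0 jm]; case: ifP => kj.
      by rewrite -boundE; apply: IH => //; rewrite kj (leq_trans (ltnW jm)).
    by rewrite /E avg_big_subtrees_small ?mulr0// ltnNge kj.
  (* This settles the case where both parts have fewer than [k] leaves. *)
  have c_mk : 2 <= c * (m%:R / k%:R) by rewrite -[2]mulr1 ler_pM.
  rewrite mij mulrDr in c_mk.
  have i_int : (0 < i < m)%N by rewrite i0.
  have j_int : (0 < m - i < m)%N.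
    by rewrite subn_gt0 im ltn_subrL i0 (ltn_trans i0 im).
  apply: le_trans (lerD (E_le i i_int) (E_le (m - i)%N j_int)) _.
  rewrite /B boundE -mulrDr -mulrBr ler_pM2l// mij mulrDr.
  have b1 : (balanced i)%:R <= 1 :> R by case: (balanced i); rewrite ?ler01.
  move: bi bj b1 c_mk; move: (c * _) (c * _) ((balanced i)%:R : R) => x y b.
  by do 2!case: ifP => _; lra.
rewrite {1}/E avg_big_subtrees_rec// -/E.
have sum_le : \sum_(1 <= i < m) sigma i (m - i)%N * (E i + E (m - i)%N) <=
    \sum_(1 <= i < m) sigma i (m - i)%N * (B - p^-1 * (balanced i)%:R).
  rewrite !big_nat; apply: ler_sum => i /andP[i0 im].
  rewrite ler_wpM2l ?split_le ?i0//.
  have mi0 : (0 < m - i)%N by rewrite subn_gt0.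
  by have /andP[] := sigma_leaf_centric.1 i (m - i)%N i0 mi0.
have sum_balanced : p <= \sum_(1 <= i < m) sigma i (m - i)%N * (balanced i)%:R.
  apply: le_trans (sp m _) _; first by rewrite m2.
  (* The hypothesis sums over [0..m]; since [m / c > 0], neither end is balanced and both terms drop
     out. *)
  have mc0 : 0 < m%:R / c by rewrite divr_gt0// ltr0n; lia.
  rewrite -(big_mkord balanced (fun i => sigma i (m - i)%N)) big_mkcond.
  rewrite big_nat_recr//= big_ltn//=; last by lia.
  have -> : balanced 0%N = false by apply/negP => /andP[]; lra.
  have -> : balanced m = false by apply/negP => /andP[]; lra.
  rewrite add0r addr0; apply: ler_sum => i _.
  by case: ifP => _; rewrite ?mulr1 ?mulr0.
apply: (le_trans (lerD (lexx 1) sum_le)).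
under eq_bigr do rewrite mulrBr mulrCA.
rewrite sumrB -mulr_suml -mulr_sumr sigma_leaf_centric.2// mul1r.
have : p^-1 * p <= p^-1 * \sum_(1 <= i < m) sigma i (m - i)%N * (balanced i)%:R.
  by rewrite ler_pM2l.
by rewrite mulVf ?gt_eqF//; lra.
Qed.

End Average.

(** * Choice of the threshold and the asymptotic bound *)

Theorem theorem3p14 (R : realType) (c : R) (phi : nat -> R)
  (sigma : nat -> nat -> R) :
  3 <= c ->
  (forall n : nat, 0 < phi n <= 1) ->
  (forall m n : nat, (m <= n)%N -> phi n <= phi m) ->
  leaf_centric sigma ->
  (forall n : nat, (2 <= n)%N ->
    phi n <= \sum_(k < n.+1 | n%:R / c <= k%:R <= n%:R - n%:R / c) sigma k (n - k)%N) ->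
  avg_dag_size sigma =O_\oo (fun n : nat => n%:R / (phi n * log2 n%:R)).
Proof.
move=> c3 phi01 phi_decr sigmaP sigma_phi.
(* [8 * c] bounds the large subtrees, through [log n <= 4 (k + 1) <= 8 k], and [4] bounds the term
   [4 ^ k]. *)
apply/eqO_exP; exists (8 * c + 4); first by lra.
near=> n.
have n16 : (16 <= n)%N by near: n; exists 16%N.
(* This is [floor (log n / 4)], so [(4 ^ k) ^ 2 <= n]; and [n >= 16] ensures [k >= 1]. *)
set k := trunc_log 16 n.
have k0 : (0 < k)%N by rewrite trunc_log_gt0.
have /andP[kn nk] : (16 ^ k <= n < 16 ^ k.+1)%N.
  by rewrite trunc_logP ?trunc_log_ltn//; lia.
have k_n : (k <= n)%N by rewrite (leq_trans _ kn)// ltnW// ltn_expl.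
have /andP[p0 p1] := phi01 n.
have nR : (0 : R) < n%:R by rewrite ltr0n; lia.
have kR : (1 : R) <= k%:R by rewrite ler1n.
have log_gt0 : 0 < log2 (n%:R : R).
  by apply: divr_gt0; rewrite ln_gt0// ltr1n// (leq_trans _ n16).
have philog_gt0 := mulr_gt0 p0 log_gt0.
have log_le : log2 (n%:R : R) <= 4 * (k%:R + 1).
  rewrite /log2 ler_pdivrMr ?ln_gt0 ?ltr1n//.
  have -> : 4 * (k%:R + 1) * ln 2 = ln ((2 : R) ^+ (4 * k.+1)).
    by rewrite lnXn// -[RHS]mulr_natl natrM -[k.+1%:R]natr1.
  rewrite ler_ln ?posrE ?exprn_gt0// -natrX ler_nat expnM.
  exact: ltnW.
have avg_le : avg_dag_size sigma n <= c * n%:R / (phi n * k%:R) + (4 ^ k)%:R.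
  rewrite avg_dag_sizeE.
  apply: (@le_trans _ _ (avg R sigma (fun t => (big_subtrees k t)%:R + (4 ^ k)%:R) n)).
    by apply: le_avg => // t; rewrite -natrD ler_nat dag_size_le.
  rewrite avgD avg_cst//; last by lia.
  rewrite lerD2r; apply: (@le_trans _ _ (c * n%:R / (phi n * k%:R) - 1 / phi n)).
    apply: (avg_big_subtrees_le R sigma sigmaP c (phi n) k n) => //; first by lra.
      (* By monotonicity [phi n] is a lower bound on the probability of a balanced split at every
         size [m <= n], so one [p] serves the whole induction. *)
      move=> m /andP[m2 mn]; exact: le_trans (phi_decr m n mn) (sigma_phi m m2).
    by rewrite k_n leqnn.
  by rewrite gerBl divr_ge0// ltW.
rewrite ger0_norm; last first.
  rewrite avg_dag_sizeE /avg; apply: sumr_ge0 => t _.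
  by rewrite mulr_ge0// tree_prob_ge0.
rewrite ger0_norm; last by apply: divr_ge0; apply: ltW.
apply: (le_trans avg_le); rewrite [leRHS]mulrDl; apply: lerD.
  have log_le8 : log2 (n%:R : R) <= 8 * k%:R by lra.
  have -> : c * n%:R / (phi n * k%:R) = c * (n%:R / phi n) * k%:R^-1.
    by field; rewrite !gt_eqF//; lra.
  have -> : 8 * c * (n%:R / (phi n * log2 n%:R)) =
            c * (n%:R / phi n) * (8 / log2 n%:R).
    by field; rewrite !gt_eqF.
  rewrite ler_pM2l; last by rewrite mulr_gt0 ?divr_gt0//; lra.
  by rewrite ler_pdivlMr// mulrC ler_pdivrMr//; lra.
rewrite mulrA ler_pdivlMr//.
(* One factor [4 ^ k] is the term to bound, the other absorbs the logarithm:
   [phi n * log n <= 4 (k + 1) <= 4 * 4 ^ k], and the product is at most [4 n]. *)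
have sq_le : (4 ^ k)%:R * (4 ^ k)%:R <= n%:R :> R.
  by rewrite -natrM ler_nat -expnMn.
have k_le : k%:R + 1 <= (4 ^ k)%:R :> R by rewrite natr1 ler_nat ltn_expl.
have philog_le : phi n * log2 n%:R <= 4 * (4 ^ k)%:R.
  apply: (@le_trans _ _ (log2 (n%:R : R))); first by rewrite ler_piMl// ltW.
  by lra.
apply: (le_trans (ler_wpM2l (ler0n _ _) philog_le)).
by rewrite mulrCA ler_pM2l.
Unshelve. all: by end_near.
Qed.
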